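(* For every $n\in\mathbb N$ there is a probabilistic online monotone embedding (which may depend on $n$) of up to $n$ points from $\ell_\infty^D$ into HSTs with distortion $O(D\log(nD))$.
   Context: $\ell_\infty^D$ is $\mathbb R^D$ with $d(u,v)=\max_i|u_i-v_i|$. For $\mu\ge1$, a $\mu$-HST is the metric on the leaves of a rooted tree with node weights $\varphi\ge0$ ($\varphi(v)=0$ iff $v$ is a leaf, $\varphi(v)\le\varphi(u)/\mu$ when $v$ is a child of $u$), leaf distance $\varphi(\mathrm{lca}(u,v))$; ''HSTs'' is the family of such metrics. An update sequence is a sequence $(v_t,o_t)\in\mathbb R^D\times\{+,-\}$ ($v_t$ arrives if $o_t=+$, leaves if $o_t=-$) with alive sets $L_0=\varnothing$, $L_t=L_{t-1}\cup\{v_t\}$ or $L_{t-1}\setminus\{v_t\}$. A deterministic online monotone embedding outputs after $\sigma_t$ (depending only on $\sigma_1,\dots,\sigma_t$) an HST metric $d_t$ on $L_t$ with $d_t\ge d$ on $L_t$ and $d_t(u,v)\le d_{t-1}(u,v)$ on $L_{t-1}\cap L_t$; a probabilistic one is a distribution over these (sequence fixed independently of the randomness), with distortion $\lambda$ if $\mathbb E[d_t(u,v)]\le\lambda d(u,v)$ for all sequences with at most $n$ points, all $t$ and $u,v\in L_t$. *)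

(* Defs.v *)
From HB Require Import structures.
From mathcomp Require Import all_boot all_order all_algebra.
From mathcomp Require Import all_classical all_reals all_analysis.
Set Implicit Arguments. Unset Strict Implicit. Unset Printing Implicit Defensive.
Import Order.TTheory GRing.Theory Num.Theory.
Local Open Scope ring_scope.

Section Defs.
Variables (R : realType) (D : nat).

Definition linf_point := 'rV[R]_D.

Definition linf (u v : linf_point) : R :=
  \big[Num.max/0]_(i < D) `|u ord0 i - v ord0 i|.

(* an update (v, o) : o = true means '+' (arrival), false means '-' (departure) *)
Definition update := (linf_point * bool)%type.

Definition alive (s : seq update) (x : linf_point) : bool :=
  foldl (fun acc (p : update) => if p.1 == x then p.2 else acc) false s.

(* A rooted tree on a finite node type V: parent map par, root r with
   par r = r, and every node reaches the root by iterating par. *)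
Definition ancestor (V : Type) (par : V -> V) (x y : V) : Prop :=
  exists k, iter k par x = y.

Definition is_child (V : Type) (par : V -> V) (root : V) (v u : V) : Prop :=
  par v = u /\ v <> root.

Definition is_leaf (V : Type) (par : V -> V) (root : V) (v : V) : Prop :=
  forall w, ~ is_child par root w v.

Definition is_lca (V : Type) (par : V -> V) (w x y : V) : Prop :=
  [/\ ancestor par x w, ancestor par y w &
      forall z, ancestor par x z -> ancestor par y z -> ancestor par w z].

Definition is_muHST (mu : R) (L : pred linf_point) (dist : linf_point -> linf_point -> R) : Prop :=
  exists (V : finType) (par : V -> V) (root : V) (phi : V -> R) (f : linf_point -> V),
    [/\ par root = root,
        (forall x, ancestor par x root),
        (forall v, 0 <= phi v),
        (forall v, phi v = 0 <-> is_leaf par root v) &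
        (forall v u, is_child par root v u -> phi v <= phi u / mu)] /\
    [/\ {in L &, injective f},
        (forall x, L x -> is_leaf par root (f x)),
        (forall v, is_leaf par root v -> exists2 x, L x & f x = v) &
        (forall x y, L x -> L y ->
           exists w, is_lca par w (f x) (f y) /\ dist x y = phi w)].

Definition is_HST (L : pred linf_point) (dist : linf_point -> linf_point -> R) : Prop :=
  (forall x, ~~ L x) \/ exists mu : R, 1 <= mu /\ is_muHST mu L dist.

(* A deterministic online algorithm maps the prefix sigma_1..sigma_t to d_t
   (so d_t depends only on sigma_1..sigma_t).  It is a monotone embedding if
   after every update: d_t is an HST metric on L_t, d_t >= d on L_t, and
   d_t <= d_{t-1} on L_{t-1} \cap L_t. *)
Definition online_monotone_embedding
    (A : seq update -> linf_point -> linf_point -> R) : Prop :=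
  forall (s : seq update) (x : update),
    [/\ is_HST (alive (rcons s x)) (A (rcons s x)),
        (forall u v, alive (rcons s x) u -> alive (rcons s x) v ->
           linf u v <= A (rcons s x) u v) &
        (forall u v, alive s u -> alive s v ->
           alive (rcons s x) u -> alive (rcons s x) v ->
           A (rcons s x) u v <= A s u v)].

End Defs.

(* Main.v *)
Require Import Defs.
From HB Require Import structures.
From mathcomp Require Import all_boot all_order all_algebra.
From mathcomp Require Import all_classical all_reals all_analysis.
From mathcomp Require Import measurable_realfun ring lra zify.
Import Order.TTheory GRing.Theory Num.Theory.
Local Open Scope ring_scope.

(** The embedding is the maximum over the coordinates of one-dimensional random
    ultrametrics, so it suffices to embed the line with distortion O(log n).

    On the line, place at every dyadic scale [2^i] randomly shifted pairs of
    cuts, four units [2^i] per pair, and let the distance of two points be 16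
    times the largest scale at which some cut separates them. A pair of points at
    distance d is cut at scale [2^i] with probability O(d/2^i), so each scale
    contributes O(d); to get rid of the scales above [n d], a cut is deleted as
    soon as it separates two points at distance less than [2^i/(n+3)], unless its
    partner was deleted before. Deletions only decrease distances, and one cut of
    each pair always survives, so the ultrametric dominates the line metric.

    At scales above [n d] a pair of points can be separated only if both cuts of
    one pair are bad, which has probability O(d/2^i) * 1/n for each history point
    at distance about [2^i]; each history point is at that distance for at most
    four scales, so these scales contribute O(d) altogether. The scales between d
    and [n d] give the factor log n. *)

Set Implicit Arguments.
Unset Strict Implicit.
Unset Printing Implicit Defensive.

(** * Finite ultrametrics are HSTs *)

Section UltrametricTree.
Variables (R : realType) (T : finType) (u : T -> T -> R).
Hypotheses (u0 : forall x, u x x = 0) (u_gt0 : forall x y, x != y -> 0 < u x y).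
Hypotheses (uC : forall x y, u x y = u y x).
Hypothesis u_ultra : forall x y z, u x z <= Num.max (u x y) (u y z).
Implicit Types (x y z : T).

Definition uball (x : T) (r : R) : {set T} := [set z | u x z <= r].
(** Radii are restricted to distances from the centre, so that radius and diameter of a ball agree;
    singletons are the balls of radius [u x x]. *)
Definition is_uball (S : {set T}) : bool :=
  [exists x, exists y, S == uball x (u x y)].

Lemma u_ge0 x y : 0 <= u x y.
Proof. by have [->|/u_gt0/ltW//] := eqVneq x y; rewrite u0. Qed.

Lemma uball_recenter x z r : z \in uball x r -> uball x r = uball z r.
Proof.
rewrite inE => xz; apply/setP => t; rewrite !inE; apply/idP/idP => h.
  by apply: le_trans (u_ultra z x t) _; rewrite ge_max h uC xz.
by apply: le_trans (u_ultra x z t) _; rewrite ge_max h xz.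
Qed.

Lemma uball_refl x y : x \in uball x (u x y).
Proof. by rewrite inE u0 u_ge0. Qed.

Lemma is_uballP (S : {set T}) : reflect (exists x y, S = uball x (u x y)) (is_uball S).
Proof.
apply: (iffP existsP) => [[x /existsP[y /eqP ->]]|[x [y ->]]]; first by exists x, y.
by exists x; apply/existsP; exists y.
Qed.

(** The radius must again be a distance from the new centre. If [u x z] equals the radius, the old
    centre [x] realizes it; otherwise [u z y = u x y] by the isosceles property of ultrametrics. *)
Lemma is_uball_at {S : {set T}} {z} : is_uball S -> z \in S -> exists y, S = uball z (u z y).
Proof.
case/is_uballP => x [y ->] zS; move: (zS); rewrite inE => xz.
have [xzy|xzy] := eqVneq (u x z) (u x y).
  by exists x; rewrite (uball_recenter zS) -xzy (uC z x).
exists y; rewrite (uball_recenter zS).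
suff -> : u z y = u x y by [].
have lt_xz : u x z < u x y by rewrite lt_neqAle xzy.
apply/le_anti/andP; split.
  by apply: le_trans (u_ultra z x y) _; rewrite ge_max lexx uC ltW.
have := u_ultra x z y; rewrite le_max => /orP[|//].
by rewrite leNgt lt_xz.
Qed.

Lemma uball_set1 x : [set x] = uball x (u x x).
Proof.
apply/setP => z; rewrite !inE u0; have [->|xz] := eqVneq z x; first by rewrite u0 lexx.
by apply/esym/negbTE; rewrite -ltNge u_gt0 // eq_sym.
Qed.

Lemma uball_nested (S S' : {set T}) z : is_uball S -> is_uball S' -> z \in S -> z \in S' ->
  (S \subset S') || (S' \subset S).
Proof.
move=> bS bS' zS zS'; have [y ->] := is_uball_at bS zS; have [y' ->] := is_uball_at bS' zS'.
have [le_yy'|/ltW le_yy'] := leP (u z y) (u z y').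
  by apply/orP; left; apply/fintype.subsetP => t; rewrite !inE => /le_trans; apply.
by apply/orP; right; apply/fintype.subsetP => t; rewrite !inE => /le_trans; apply.
Qed.

Lemma is_uball_neq0 (S : {set T}) : is_uball S -> exists z, z \in S.
Proof. by case/is_uballP => x [y ->]; exists x; rewrite uball_refl. Qed.

Definition udiam (S : {set T}) : R :=
  \big[Num.max/0]_(x in S) \big[Num.max/0]_(y in S) u x y.

Lemma udiam_ge (S : {set T}) x y : x \in S -> y \in S -> u x y <= udiam S.
Proof.
move=> xS yS; rewrite /udiam (bigD1 x) //= le_max; apply/orP; left.
by rewrite (bigD1 y) //= le_max lexx.
Qed.

Lemma udiam_le (S : {set T}) r : 0 <= r -> (forall x y, x \in S -> y \in S -> u x y <= r) ->
  udiam S <= r.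
Proof.
move=> r0 h; rewrite /udiam; elim/big_ind: _ => // [a b|x xS]; first by rewrite ge_max => -> ->.
elim/big_ind: _ => // [a b|y yS]; first by rewrite ge_max => -> ->.
exact: h.
Qed.

Lemma udiam_ge0 (S : {set T}) : 0 <= udiam S.
Proof.
rewrite /udiam; elim/big_ind: _ => // [a b a0 b0|x xS]; first by rewrite le_max a0.
elim/big_ind: _ => // [a b a0 b0|y _]; first by rewrite le_max a0.
exact: u_ge0.
Qed.

Lemma udiam_ball x y : udiam (uball x (u x y)) = u x y.
Proof.
apply/le_anti/andP; split; last first.
  by apply: udiam_ge; rewrite ?uball_refl ?inE.
apply: udiam_le => [|a b]; first exact: u_ge0.
rewrite !inE => xa xb; apply: le_trans (u_ultra a x b) _.
by rewrite ge_max xb uC xa.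
Qed.

Lemma udiam_sub (S S' : {set T}) : S \subset S' -> udiam S <= udiam S'.
Proof.
move/fintype.subsetP => h; apply: udiam_le => [|x y xS yS]; first exact: udiam_ge0.
by apply: udiam_ge; apply: h.
Qed.

Definition unode := {S : {set T} | is_uball S}.
Implicit Types (S v w : unode).

Lemma uleaf_subproof x : is_uball [set x].
Proof. by apply/is_uballP; exists x, x; rewrite uball_set1. Qed.
Definition uleaf x : unode := exist (fun S : {set T} => is_uball S) _ (uleaf_subproof x).

Variable x0 : T.

Lemma uroot_subproof : is_uball [set: T].
Proof.
apply/is_uballP; exists x0, [arg max_(y > x0) u x0 y]%O.
case: arg_maxP => // y _ ymax; apply/setP => z; rewrite !inE.
by apply/esym; apply: ymax.
Qed.
Definition uroot : unode := exist (fun S : {set T} => is_uball S) _ uroot_subproof.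

(** A strictly larger ball of least cardinality; the root has none and is its own parent. *)
Definition upar (S : unode) : unode :=
  if [pick S' : unode | val S \proper val S'] is Some S0
  then [arg min_(S' < S0 | val S \proper val S') #|val S'| ]%N else S.

Variant upar_spec (S : unode) : unode -> Prop :=
| UparRoot of S = uroot : upar_spec S S
| UparStep S' of S <> uroot & val S \proper val S' &
    (forall S2 : unode, val S \proper val S2 -> val S' \subset val S2) : upar_spec S S'.

Lemma sub_uroot (S : unode) : val S \subset val uroot.
Proof. exact: finset.subsetT. Qed.

(** Balls sharing a point are nested, so a strictly larger ball of least cardinality is also least
    for inclusion. *)
Lemma uparP (S : unode) : upar_spec S (upar S).
Proof.
rewrite /upar; case: pickP => [S0 SS0|nS].
  case: arg_minnP => // S' SS' S'min; apply: UparStep => //.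
    move=> eS; move: SS'; rewrite eS => /proper_card; rewrite /= cardsT.
    by rewrite ltnNge max_card.
  move=> S2 SS2; have [z zS] := is_uball_neq0 (valP S).
  have /fintype.subsetP/(_ z zS) zS' := proper_sub SS'.
  have /fintype.subsetP/(_ z zS) zS2 := proper_sub SS2.
  case/orP: (uball_nested (valP S') (valP S2) zS' zS2) => // S2S'.
  by have := S'min _ SS2; rewrite leqNgt; apply: contraR => S'S2;
    apply: proper_card; rewrite properE S2S'.
apply: UparRoot; apply/val_inj/eqP; rewrite finset.eqEsubset sub_uroot /=.
by have := nS uroot; rewrite properE sub_uroot /= => /negbFE.
Qed.

Lemma upar_sub (S : unode) : val S \subset val (upar S).
Proof. by case: uparP => // S' _ /proper_sub. Qed.

Lemma upar_root : upar uroot = uroot.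
Proof. by case: uparP. Qed.

(** For the converse, induct on the number of points outside [S]: the parent of [S] is the least
    ball strictly above it, hence still inside [S']. *)
Lemma ancestor_uparP (S S' : unode) : ancestor upar S S' <-> val S \subset val S'.
Proof.
split=> [[k <-]|].
  by elim: k => //= k; move=> h; apply: fintype.subset_trans h (upar_sub _).
have [m] := ubnP (#|T| - #|val S|); elim: m S => // m IH S lt_m SS'.
have [eS|neS] := eqVneq S S'; first by exists 0%N.
have pSS' : val S \proper val S'.
  by rewrite finset.properEneq SS' andbT (inj_eq val_inj).
case eS2: _ / (uparP S) => [eS|S2 _ pSS2 S2min].
  move: pSS'; rewrite eS => /proper_card; rewrite /= cardsT.
  by rewrite ltnNge max_card.
have [k <-] : ancestor upar S2 S'.
  apply: IH (S2min _ pSS').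
  apply: leq_trans (lt_m : (#|T| - #|val S| <= m)%N); rewrite ltn_sub2l ?(proper_card pSS2)//.
  by apply: leq_trans (proper_card pSS2) (max_card _).
by exists k.+1; rewrite iterSr eS2.
Qed.

Lemma uchild_proper w v : is_child upar uroot w v -> val w \proper val v.
Proof. by case=> <- wr; case: uparP. Qed.

Lemma last_step (S S' : unode) : ancestor upar S S' -> S <> S' ->
  exists2 w, upar w = S' & w <> S'.
Proof.
case=> k; elim: k S => [|k IH] S /=; first by move=> -> /(_ erefl).
rewrite -iterS iterSr => h ne; have [e|e] := pselect (upar S = S').
  by exists S.
exact: IH h e.
Qed.

Lemma is_leaf_uleaf x : is_leaf upar uroot (uleaf x).
Proof.
move=> w /uchild_proper pw; have [z zw] := is_uball_neq0 (valP w).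
have := proper_card pw; rewrite /= cards1 ltnS leqn0 cards_eq0 => /eqP w0.
by move: zw => /=; rewrite w0 finset.in_set0.
Qed.

Lemma is_leafP v : is_leaf upar uroot v <-> exists x, v = uleaf x.
Proof.
split=> [lv|[x ->]]; last exact: is_leaf_uleaf.
have [x xv] := is_uball_neq0 (valP v); exists x; apply: contrapT => ne.
have anc : ancestor upar (uleaf x) v by apply/ancestor_uparP; rewrite finset.sub1set.
have [w ew wv] := last_step anc (fun e => ne (esym e)).
apply: (lv w); split => // wr; apply: wv; rewrite -ew wr upar_root //.
Qed.

Lemma udiam_leaf v : udiam (val v) = 0 <-> is_leaf upar uroot v.
Proof.
rewrite is_leafP; split=> [v0|[x ->]]; last by rewrite /= uball_set1 udiam_ball u0.
have [x xv] := is_uball_neq0 (valP v); exists x; apply: val_inj.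
apply/setP => y; rewrite /= inE; apply/idP/eqP => [yv|->//].
apply/eqP; apply: contraT => /u_gt0; rewrite -v0 => /lt_le_trans /(_ (udiam_ge yv xv)).
by rewrite ltxx.
Qed.

Lemma uleaf_inj : injective uleaf.
Proof. by move=> x y /(congr1 val)/set1_inj. Qed.

Lemma uball_is_ball x y : is_uball (uball x (u x y)).
Proof. by apply/is_uballP; exists x, y. Qed.

(** The witness is the ball around [x] of radius [u x y]. Any ball containing both points can be
    recentred at [x], and its radius is then at least [u x y]. *)
Lemma uleaf_lca x y : exists w : unode,
  is_lca upar w (uleaf x) (uleaf y) /\ u x y = udiam (val w).
Proof.
exists (exist (fun S : {set T} => is_uball S) _ (uball_is_ball x y)); split; last by rewrite udiam_ball.
split; [by apply/ancestor_uparP; rewrite finset.sub1set uball_refl|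
  by apply/ancestor_uparP; rewrite finset.sub1set inE|].
move=> z /ancestor_uparP; rewrite finset.sub1set => xz /ancestor_uparP; rewrite finset.sub1set => yz.
apply/ancestor_uparP; have [t et] := is_uball_at (valP z) xz.
move: yz; rewrite et inE => xyt.
by apply/fintype.subsetP => s; rewrite !inE => /le_trans; apply.
Qed.

End UltrametricTree.

(** The list [X] makes [L] finite. The ratio of the HST is 1, since diameters of nested balls are
    merely monotone. *)
Lemma ultrametric_is_HST (R : realType) (D : nat) (X : seq (linf_point R D))
    (L : pred (linf_point R D)) (dist : linf_point R D -> linf_point R D -> R) :
  (forall x, L x -> x \in X) ->
  (forall x, L x -> dist x x = 0) ->
  (forall x y, L x -> L y -> x != y -> 0 < dist x y) ->
  (forall x y, L x -> L y -> dist x y = dist y x) ->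
  (forall x y z, L x -> L y -> L z -> dist x z <= Num.max (dist x y) (dist y z)) ->
  is_HST L dist.
Proof.
move=> LX d0 dgt dC du.
have [[x Lx]|nL] := pselect (exists x, L x); last first.
  by left=> x; apply/negP => Lx; apply: nL; exists x.
right; exists 1; split => //.
pose Y := [seq x <- X | L x].
have memY y : (y \in Y) = L y.
  by rewrite mem_filter andbC; case: (boolP (L y)) => [/LX ->|]; rewrite ?andbF.
pose T : finType := seq_sub Y.
have LT (t : T) : L (val t) by rewrite -memY; exact: valP.
have xY : x \in Y by rewrite memY.
pose x0 : T := SeqSub xY.
pose u (s t : T) := dist (val s) (val t).
have u0 s : u s s = 0 by exact: d0.
have ugt s t : s != t -> 0 < u s t.
  by move=> st; apply: dgt.
have uC s t : u s t = u t s by exact: dC.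
have uu s t r : u s r <= Num.max (u s t) (u t r) by exact: du.
(* Points outside [L] go to the default leaf of [x0]. *)
pose f y : unode u := uleaf u0 ugt (insubd x0 y).
exists (unode u), (upar (u := u)), (uroot u x0), (fun v => udiam u (val v)), f.
have fval y : L y -> val (insubd x0 y : T) = y.
  by move=> Ly; rewrite insubdK // -topredE /= memY.
split; split.
- exact: upar_root.
- move=> v; apply/(ancestor_uparP u0 ugt uC uu x0); exact: sub_uroot.
- by move=> v; apply: udiam_ge0.
- by move=> v; apply: udiam_leaf.
- move=> v w /(uchild_proper u0 ugt uC uu)/proper_sub; rewrite divr1.
  exact: udiam_sub.
- move=> y z Ly Lz /uleaf_inj/(congr1 val).
  by rewrite !fval.
- by move=> y _; exact: is_leaf_uleaf.
- move=> v /(is_leafP u0 ugt uC uu)[t ->]; exists (val t) => //.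
  by rewrite /f valKd.
- move=> y z Ly Lz; have [w [lw ew]] := uleaf_lca u0 ugt uC uu x0 (insubd x0 y) (insubd x0 z).
  by exists w; split => //; rewrite -ew /u !fval.
Qed.

(** * The cut ultrametric on the line *)

Section CutPairs.
Variable R : realType.
Implicit Types (th a b c x y z : R) (h : seq R).

Definition bad_cut th h c : bool :=
  has (fun p => has (fun q => [&& p <= c, c < q & q - p < th]) h) h.

Lemma bad_cutP th h c :
  reflect (exists p q, [/\ p \in h, q \in h, p <= c, c < q & q - p < th])
    (bad_cut th h c).
Proof.
apply: (iffP hasP) => [[p ph /hasP[q qh /and3P[]]]|[p [q [ph qh pc cq pq]]]].
  by exists p, q.
by exists p => //; apply/hasP; exists q => //; apply/and3P.
Qed.

Lemma bad_cut_cons th h c x : bad_cut th h c -> bad_cut th (x :: h) c.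
Proof.
move=> /bad_cutP[p [q [ph qh ? ? ?]]]; apply/bad_cutP; exists p, q.
by rewrite !inE ph qh !orbT.
Qed.

(* Histories list the newest point first.  A bad cut is deleted, except that a
   cut survives once its partner is gone; deletions are never undone. *)
Fixpoint pair_status th a b h : bool * bool :=
  if h is _ :: h' then
    let: (sa, sb) := pair_status th a b h' in
    let sa' := sa && ~~ (bad_cut th h a && sb) in
    (sa', sb && ~~ (bad_cut th h b && sa'))
  else (true, true).

(** The second cut is updated against the new status of the first, so one step cannot delete
    both. *)
Lemma pair_status_one th a b h :
  (pair_status th a b h).1 || (pair_status th a b h).2.
Proof.
elim: h => //= x h; case: (pair_status _ _ _ _) => sa sb /=.
by case: sa; case: sb; case: bad_cut; case: bad_cut.
Qed.

Lemma pair_status_cons1 th a b h x :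
  (pair_status th a b (x :: h)).1 -> (pair_status th a b h).1.
Proof. by move=> /=; case: (pair_status _ _ _ _) => sa sb /= /andP[]. Qed.

Lemma pair_status_cons2 th a b h x :
  (pair_status th a b (x :: h)).2 -> (pair_status th a b h).2.
Proof. by move=> /=; case: (pair_status _ _ _ _) => sa sb /= /andP[]. Qed.

Lemma pair_status_dead th a b h :
  (~~ (pair_status th a b h).1 -> bad_cut th h a) /\
  (~~ (pair_status th a b h).2 -> bad_cut th h b).
Proof.
elim: h => //= x h; case: (pair_status _ _ _ _) => sa sb /= [IHa IHb].
split.
  case: sa IHa => [_|IHa _] /=; last exact/bad_cut_cons/IHa.
  by rewrite negbK => /andP[].
case: sb IHb => [_|IHb _] /=; last exact/bad_cut_cons/IHb.
by rewrite negbK => /andP[].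
Qed.

(** A bad cut survives an update only if its partner is gone, and a deleted cut is bad by
    [pair_status_dead]. *)
Lemma pair_status_bad1 th a b h :
  (pair_status th a b h).1 -> bad_cut th h a -> bad_cut th h b.
Proof.
move=> alive_a bad_a; apply: (pair_status_dead th a b h).2.
case: h alive_a bad_a => //= x h; case: (pair_status _ _ _ _) => sa sb /=.
by move=> /andP[-> nb] bad_a; move: nb; rewrite bad_a /= => /negbTE ->.
Qed.

Lemma pair_status_bad2 th a b h :
  (pair_status th a b h).2 -> bad_cut th h b -> bad_cut th h a.
Proof.
move=> alive_b bad_b; apply: (pair_status_dead th a b h).1.
case: h alive_b bad_b => //= x h; case: (pair_status _ _ _ _) => sa sb /=.
by move=> /andP[_ nb] bad_b; move: nb; rewrite bad_b.
Qed.

Definition separates c x y : bool := (x <= c) (+) (y <= c).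

Lemma separatesC c x y : separates c x y = separates c y x.
Proof. by rewrite /separates addbC. Qed.

Lemma separatesxx c x : separates c x x = false.
Proof. by rewrite /separates addbb. Qed.

Lemma separates_trans c x y z : separates c x z -> separates c x y || separates c y z.
Proof. by rewrite /separates; do 3!case: (_ <= c). Qed.

Lemma separatesE c x y : x <= y -> separates c x y = (x <= c < y).
Proof.
move=> xy; rewrite /separates ltNge; case: (leP y c) => [yc|_]; last by rewrite addbF andbT.
by rewrite (le_trans xy yc).
Qed.

(** Seeds range over all real pairs. Clamping makes the geometry of the cuts, and with it domination
    and monotonicity, hold for every seed and not just almost surely. *)
Definition clamp01 x : R := Num.max 0 (Num.min 1 x).

Lemma clamp01_ge0 x : 0 <= clamp01 x.
Proof. by rewrite /clamp01 le_max lexx. Qed.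

Lemma clamp01_le1 x : clamp01 x <= 1.
Proof. by rewrite /clamp01 ge_max ler01 ge_min lexx. Qed.

Lemma clamp01_id x : 0 <= x <= 1 -> clamp01 x = x.
Proof. by case/andP=> x0 x1; rewrite /clamp01 min_r // max_r. Qed.

Local Notation pow2 i := ((2 : R) ^ (i : int)).

Lemma pow2_gt0 (i : int) : 0 < pow2 i.
Proof. by rewrite exprz_gt0. Qed.

(* A pair at level [i]: positions [U] and [2 + V], with [U], [V] in [[0, 1]],
   inside the [j]-th block of length 4, scaled by [2 ^ i]. *)
Definition cut1 (w : R * R) (i j : int) : R := pow2 i * (4 * j%:~R + clamp01 w.1).
Definition cut2 (w : R * R) (i j : int) : R := pow2 i * (4 * j%:~R + 2 + clamp01 w.2).

Variable N : nat.

Definition threshold (i : int) : R := pow2 i / N.+1%:R.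

Definition status w h (i j : int) :=
  pair_status (threshold i) (cut1 w i j) (cut2 w i j) h.

Definition cut_alive w h x y (i : int) (j : int) : bool :=
  (separates (cut1 w i j) x y && (status w h i j).1) ||
  (separates (cut2 w i j) x y && (status w h i j).2).

Definition cut_level w h x y (i : int) : Prop := exists j, cut_alive w h x y i j.

Definition levels w h x y : set R :=
  [set r | exists2 i : int, cut_level w h x y i & r = 16 * pow2 i].

(* [sup] is 0 on unbounded sets; [levels] is bounded only when [x] and [y]
   belong to [h]. *)
Definition hdist w h x y : R := sup (levels w h x y).

Lemma cut_levelC w h x y i : cut_level w h x y i -> cut_level w h y x i.
Proof. by case=> j jP; exists j; rewrite /cut_alive separatesC (separatesC _ y). Qed.

Lemma levelsC w h x y : levels w h x y = levels w h y x.
Proof. by apply/seteqP; split=> r [i /cut_levelC ? ->]; exists i. Qed.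

Lemma hdistC w h x y : hdist w h x y = hdist w h y x.
Proof. by rewrite /hdist levelsC. Qed.

Lemma hdistxx w h x : hdist w h x x = 0.
Proof.
rewrite /hdist (_ : levels w h x x = set0) ?sup0 //.
by apply/seteqP; split=> r // [i [j]]; rewrite /cut_alive !separatesxx.
Qed.

Lemma hdist_le w h x y r : 0 <= r ->
  (forall i, cut_level w h x y i -> 16 * pow2 i <= r) -> hdist w h x y <= r.
Proof.
move=> r0 hr; rewrite /hdist.
have [->|/set0P ne] := eqVneq (levels w h x y) set0; first by rewrite sup0.
by apply: ge_sup => // _ [i hi ->]; apply: hr.
Qed.

(* A surviving bad cut has a bad partner, so the history spans at least the
   distance between the two, which is at least [2 ^ i]. *)
Lemma cut_level_bound w h x y i (B : R) : x \in h -> y \in h ->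
  (forall p q, p \in h -> q \in h -> q - p <= B) ->
  cut_level w h x y i -> pow2 i <= N.+1%:R * B.
Proof.
move=> xh yh hB; wlog xy : x y xh yh / x <= y.
  by move=> hw; case: (leP x y) => [|/ltW] xy; [exact: hw|move/cut_levelC; exact: hw].
have B0 : 0 <= B by rewrite -(subrr x); apply: hB.
have N1 : 1 <= N.+1%:R :> R by rewrite ler1n.
case: (leP (threshold i) (y - x)) => [big _|small [j]].
  have := le_trans big (hB _ _ xh yh); rewrite /threshold ler_pdivrMr ?ltr0n //.
  by rewrite mulrC.
have c12 : pow2 i <= cut2 w i j - cut1 w i j.
  rewrite /cut1 /cut2 -mulrBr ler_peMr ?(ltW (pow2_gt0 _)) //.
  by have := clamp01_ge0 w.2; have := clamp01_le1 w.1; lra.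
have key : bad_cut (threshold i) h (cut1 w i j) -> bad_cut (threshold i) h (cut2 w i j) ->
    pow2 i <= N.+1%:R * B.
  move=> /bad_cutP[p [q [ph qh pc cq _]]] /bad_cutP[p' [q' [ph' qh' pc' cq' _]]].
  have := hB _ _ ph qh' => pB; apply: (@le_trans _ _ B); last by rewrite ler_peMl.
  by lra.
have sep c : separates c x y -> bad_cut (threshold i) h c.
  by rewrite separatesE // => /andP[xc cy]; apply/bad_cutP; exists x, y.
rewrite /cut_alive => /orP[] /andP[/sep bc].
  by move=> s1; apply: key => //; apply: pair_status_bad1 s1 bc.
by move=> s1; apply: key => //; apply: pair_status_bad2 s1 bc.
Qed.

Lemma history_diam h : exists B : R, forall p q, p \in h -> q \in h -> q - p <= B.
Proof.
exists (\sum_(p <- h) \sum_(q <- h) `|q - p|) => p q ph qh.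
apply: le_trans (ler_norm _) _.
rewrite (big_rem p) //= (big_rem q) //= -addrA lerDl addr_ge0 ?sumr_ge0 //.
by move=> r _; apply: sumr_ge0.
Qed.

Lemma levels_has_ubound w h x y : x \in h -> y \in h -> has_ubound (levels w h x y).
Proof.
move=> xh yh; have [B hB] := history_diam h.
exists (16 * (N.+1%:R * B)) => _ [i hi ->].
by rewrite ler_pM2l //; apply: cut_level_bound hB hi.
Qed.

Lemma exists_dyadic (r : R) : 0 < r -> exists i : int, pow2 i <= r < pow2 (i + 1).
Proof.
move=> r0.
(* Bounding the sum gives [2 ^ (- m) < r < 2 ^ m], so the exponent can be searched among naturals
   shifted by [m]. *)
pose m := Num.bound (r + r^-1).
have hm : r + r^-1 < pow2 m.
  have rr0 : 0 <= r + r^-1 by rewrite addr_ge0 ?invr_ge0 ?(ltW r0).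
  apply: lt_le_trans (Num.Theory.archi_boundP rr0) _.
  by rewrite -exprnP -natrX ler_nat ltnW // ltn_expl.
have ri0 : 0 < r^-1 by rewrite invr_gt0.
have exP : exists k : nat, r < pow2 (k%:Z - m%:Z).
  exists (m + m)%N; rewrite PoszD addrK; apply: le_lt_trans hm.
  by rewrite lerDl ltW.
case: (ex_minnP exP) => k rk kmin; case: k rk kmin => [|k] rk kmin.
  exfalso; move: rk; rewrite add0r -exprnN => rk.
  have : r^-1 < pow2 m by apply: lt_trans hm; rewrite ltrDr.
  rewrite -exprnP ltNge => /negP; apply.
  by rewrite -[leLHS]invrK lef_pV2 ?posrE ?invr_gt0 ?exprn_gt0 // ltW.
exists (k%:Z - m%:Z); apply/andP; split; last first.
  by rewrite (_ : k%:Z - m%:Z + 1 = k.+1%:Z - m%:Z) // intS; ring.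
by rewrite leNgt; apply/negP => /kmin; rewrite ltnn.
Qed.

Lemma dyadic_bracket x y : x != y ->
  exists i, 8 * pow2 i <= `|x - y| < 16 * pow2 i.
Proof.
move=> xy; have [|i /andP[i1 i2]] := @exists_dyadic (`|x - y| / 8).
  by rewrite divr_gt0 // normr_gt0 subr_eq0.
exists i; move: i1 i2; rewrite expfzDr // expr1z ler_pdivlMr // ltr_pdivrMr // => *.
by apply/andP; split; lra.
Qed.

(* An interval of length [8 * 2 ^ i] contains a whole pair of cuts of level [i]. *)
Lemma cut_level_exists w h x y i :
  8 * pow2 i <= `|x - y| -> cut_level w h x y i.
Proof.
wlog xy : x y / x <= y.
  move=> hw; case: (leP x y) => [|/ltW] xy; [exact: hw|].
  by rewrite distrC => /(hw _ _ xy)/cut_levelC.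
rewrite distrC ger0_norm ?subr_ge0 // => long.
have i0 := pow2_gt0 i.
(* The first block starting at or after [x] starts less than [4 * 2 ^ i] beyond it, and its cuts lie
   at most [3 * 2 ^ i] further on, hence before [y]. *)
pose j := Num.ceil (x / (4 * pow2 i)).
have j1 : x <= pow2 i * (4 * j%:~R).
  have := Num.Theory.ceil_ge (x / (4 * pow2 i)).
  by rewrite ler_pdivrMr ?mulr_gt0 // => /le_trans; apply; rewrite -/j; lra.
have j2 : pow2 i * (4 * j%:~R) < x + 4 * pow2 i.
  have := Num.Theory.ceilB1_lt (x / (4 * pow2 i)).
  rewrite ltr_pdivlMr ?mulr_gt0 // intrB -/j; lra.
have sep t : 0 <= t <= 3 -> separates (pow2 i * (4 * j%:~R + t)) x y.
  move=> /andP[t0 t3]; rewrite separatesE // mulrDr; apply/andP; split.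
    by rewrite (le_trans j1) // lerDl mulr_ge0 // ltW.
  apply: lt_le_trans (_ : x + 4 * pow2 i + pow2 i * 3 <= _); last by lra.
  by rewrite ltr_leD // ler_pM2l.
exists j; rewrite /cut_alive.
have -> : separates (cut1 w i j) x y.
  by apply: sep; have := clamp01_ge0 w.1; have := clamp01_le1 w.1; lra.
have -> : separates (cut2 w i j) x y.
  rewrite /cut2 -addrA; apply: sep.
  by have := clamp01_ge0 w.2; have := clamp01_le1 w.2; lra.
exact: pair_status_one.
Qed.

Lemma cut_level_hdist w h x y i : x \in h -> y \in h ->
  cut_level w h x y i -> 16 * pow2 i <= hdist w h x y.
Proof.
move=> xh yh hi; apply: ub_le_sup; first exact: levels_has_ubound.
by exists i.
Qed.

(** The level [i] with [8 * 2 ^ i <= |x - y| < 16 * 2 ^ i] always separates the points, and it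
    contributes [16 * 2 ^ i]. *)
Lemma hdist_ge w h x y : x \in h -> y \in h -> `|x - y| <= hdist w h x y.
Proof.
move=> xh yh; have [->|/dyadic_bracket[i /andP[long short]]] := eqVneq x y.
  by rewrite subrr normr0 hdistxx.
apply: le_trans (ltW short) (cut_level_hdist xh yh _).
exact: cut_level_exists.
Qed.

Lemma hdist_ge0 w h x y : x \in h -> y \in h -> 0 <= hdist w h x y.
Proof. by move=> xh yh; apply: le_trans (hdist_ge w xh yh). Qed.

(** A cut separating [x] from [z] separates one of them from [y], and whether it is alive does not
    depend on the pair of points. *)
Lemma hdist_ultra w h x y z : x \in h -> y \in h -> z \in h ->
  hdist w h x z <= Num.max (hdist w h x y) (hdist w h y z).
Proof.
move=> xh yh zh; apply: hdist_le => [|i [j]]; first by rewrite le_max hdist_ge0.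
rewrite le_max => hj; apply/orP.
suff [hi|hi] : cut_level w h x y i \/ cut_level w h y z i.
- by left; apply: cut_level_hdist.
- by right; apply: cut_level_hdist.
move: hj; rewrite /cut_alive => /orP[] /andP[/(@separates_trans _ _ y _)/orP[] sj s].
- by left; exists j; rewrite /cut_alive sj s.
- by right; exists j; rewrite /cut_alive sj s.
- by left; exists j; rewrite /cut_alive sj s orbT.
- by right; exists j; rewrite /cut_alive sj s orbT.
Qed.

Lemma cut_level_cons w h x y z i : cut_level w (z :: h) x y i -> cut_level w h x y i.
Proof.
case=> j; rewrite /cut_alive => /orP[] /andP[sj] s; exists j; apply/orP; [left|right];
  rewrite sj /=; [exact: pair_status_cons1 s|exact: pair_status_cons2 s].
Qed.

Lemma hdist_cons w h x y z : x \in h -> y \in h ->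
  hdist w (z :: h) x y <= hdist w h x y.
Proof.
move=> xh yh; apply: hdist_le => [|i /cut_level_cons hi]; first exact: hdist_ge0.
exact: cut_level_hdist.
Qed.

End CutPairs.

(** * Random cuts *)

Section RandomCuts.
Variable R : realType.
Local Open Scope classical_set_scope.
Local Notation pow2 i := ((2 : R) ^ (i : int)).
Local Notation seed := (measurableTypeR R * measurableTypeR R)%type.
Implicit Types (x y : R) (h : seq R) (i j : int).

Definition coord_prob : probability (measurableTypeR R) R := uniform_prob (@ltr01 R).
Definition seed_prob : probability seed R := (coord_prob \x coord_prob)%E.

Section Measurability.
Context (d : measure_display) (T : measurableType d).

Lemma measurable_has (A : eqType) (f : A -> T -> bool) (s : seq A) :
  (forall a, measurable_fun setT (f a)) ->
  measurable_fun setT (fun w => has (fun a => f a w) s).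
Proof.
move=> mf; elim: s => [|a s IH] /=; first exact: measurable_cst.
exact: measurable_or.
Qed.

Lemma measurable_bad_cut th h (c : T -> R) : measurable_fun setT c ->
  measurable_fun setT (fun w => bad_cut th h (c w)).
Proof.
move=> mc; apply: measurable_has => p; apply: measurable_has => q.
apply: measurable_and; first exact: measurable_fun_ler.
apply: measurable_and; first exact: measurable_fun_ltr.
exact: measurable_cst.
Qed.

Lemma measurable_pair_status th h (a b : T -> R) :
  measurable_fun setT a -> measurable_fun setT b ->
  measurable_fun setT (fun w => (pair_status th (a w) (b w) h).1) /\
  measurable_fun setT (fun w => (pair_status th (a w) (b w) h).2).
Proof.
move=> ma mb; elim: h => [|x h [IHa IHb]]; first by split; exact: measurable_cst.
set sa := fun w => (pair_status th (a w) (b w) (x :: h)).1.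
have saE : sa = fun w => (pair_status th (a w) (b w) h).1 &&
    ~~ (bad_cut th (x :: h) (a w) && (pair_status th (a w) (b w) h).2).
  by apply/funext => w; rewrite /sa /=; case: pair_status.
have msa : measurable_fun setT sa.
  rewrite saE; apply: measurable_and => //; apply: measurable_neg.
  by apply: measurable_and => //; exact: measurable_bad_cut.
split => //; rewrite [X in measurable_fun _ X](_ : _ = fun w =>
    (pair_status th (a w) (b w) h).2 && ~~ (bad_cut th (x :: h) (b w) && sa w)).
  apply: measurable_and => //; apply: measurable_neg.
  by apply: measurable_and => //; exact: measurable_bad_cut.
by apply/funext => w; rewrite /sa /=; case: pair_status.
Qed.

Lemma measurable_separates x y (c : T -> R) : measurable_fun setT c ->
  measurable_fun setT (fun w => separates (c w) x y).
Proof.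
move=> mc; rewrite [X in measurable_fun _ X](_ : _ = fun w =>
   (x <= c w) && ~~ (y <= c w) || ~~ (x <= c w) && (y <= c w)); last first.
  by apply/funext => w; rewrite /separates; do 2!case: (_ <= c w).
have m1 t : measurable_fun setT (fun w => t <= c w) by exact: measurable_fun_ler.
by apply: measurable_or; apply: measurable_and => //; exact: measurable_neg.
Qed.

End Measurability.

Lemma measurable_clamp01 : measurable_fun setT (@clamp01 R).
Proof. by apply: measurable_maxr => //; apply: measurable_minr. Qed.

Lemma measurable_clamp_coord (b : bool) :
  measurable_fun setT (fun w : seed => clamp01 (if b then w.2 else w.1)).
Proof.
by case: b; apply: (measurableT_comp measurable_clamp01);
  [exact: measurable_snd|exact: measurable_fst].
Qed.

Lemma measurable_cut1 i j : measurable_fun setT (fun w : seed => cut1 w i j).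
Proof.
apply: measurable_funM => //; apply: measurable_funD => //.
exact: (measurable_clamp_coord false).
Qed.

Lemma measurable_cut2 i j : measurable_fun setT (fun w : seed => cut2 w i j).
Proof.
apply: measurable_funM => //; apply: measurable_funD => //.
exact: (measurable_clamp_coord true).
Qed.

Lemma measurable_cut_level N h x y i :
  measurable [set w : seed | cut_level N w h x y i].
Proof.
rewrite [X in measurable X](_ : _ =
    \bigcup_(j : int) [set w : seed | cut_alive N w h x y i j]); last first.
  by apply/seteqP; split=> w /= [j]; [exists j|move=> _; exists j].
apply: countable_bigcupT_measurable => [|j]; first exact: countableP.
have m1 := measurable_cut1 i j; have m2 := measurable_cut2 i j.
have [ms1 ms2] := measurable_pair_status (threshold R N i) h m1 m2.
have : measurable_fun setT (fun w : seed => cut_alive N w h x y i j).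
  by apply: measurable_or; apply: measurable_and => //; exact: measurable_separates.
by move=> /(_ measurableT [set true]) /(_ I); rewrite setTI.
Qed.

(* A bound on the outer probability of an event that need not be measurable. *)
Definition small (E : set seed) (e : R) :=
  exists F : set seed, [/\ measurable F, E `<=` F & (seed_prob F <= e%:E)%E].

Lemma small_sub E E' e e' : E' `<=` E -> e <= e' -> small E e -> small E' e'.
Proof.
move=> EE' ee' [F [mF EF Fe]]; exists F; split => //.
  exact: subset_trans EE' EF.
by rewrite (le_trans Fe) // lee_fin.
Qed.

Lemma smallU E E' e e' : small E e -> small E' e' -> small (E `|` E') (e + e').
Proof.
move=> [F [mF EF Fe]] [F' [mF' EF' Fe']]; exists (F `|` F'); split.
- exact: measurableU.
- exact: setUSS.
- by rewrite (le_trans (measureU2 _ _ _)) // EFinD leeD.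
Qed.

Lemma small0 E e : (forall w, ~ E w) -> 0 <= e -> small E e.
Proof.
move=> E0 e0; exists set0; split => //.
by rewrite measure0 lee_fin.
Qed.

Lemma small1 E e : 1 <= e -> small E e.
Proof.
by move=> e1; exists setT; split => //; rewrite probability_setT lee_fin.
Qed.

Lemma small_has (A : eqType) (s : seq A) (E : A -> set seed) (e : A -> R) :
  (forall a, a \in s -> small (E a) (e a)) ->
  small [set w | exists2 a, a \in s & E a w] (\sum_(a <- s) e a).
Proof.
elim: s => [|a s IH] hs; first by rewrite big_nil; apply: small0 => // w [].
rewrite big_cons; apply: small_sub (lexx _) (smallU (hs a (mem_head _ _)) (IH _)).
  move=> w [b]; rewrite inE => /predU1P[->|bs] Eb; first by left.
  by right; exists b.
by move=> b bs; apply: hs; rewrite inE bs orbT.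
Qed.

Lemma small_measure E e : measurable E -> small E e -> (seed_prob E <= e%:E)%E.
Proof.
by move=> mE [F [mF EF]]; apply: le_trans; apply: le_measure; rewrite ?inE.
Qed.

(** The uniform law has no mass outside [[0, 1]], and inside the clamp is the identity. *)
Lemma coord_prob_interval (c l : R) : 0 <= l ->
  measurable [set u : measurableTypeR R | c <= clamp01 u < c + l] /\
  (coord_prob [set u | (c <= clamp01 u < c + l)%R] <= l%:E)%E.
Proof.
move=> l0; set A := [set u | _].
have mA : measurable A.
  have : measurable_fun setT (fun u : measurableTypeR R => c <= clamp01 u < c + l).
    by apply: measurable_and; [apply: measurable_fun_ler|apply: measurable_fun_ltr] => //;
      exact: measurable_clamp01.
  by move=> /(_ measurableT [set true]) /(_ I); rewrite setTI.
split => //; rewrite /coord_prob /= /uniform_prob integral_uniform_pdf.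
have m01 : measurable (A `&` `[0%R, 1%R]) by exact: measurableI.
rewrite (eq_integral (fun=> 1%:E)); last first.
  move=> u; rewrite inE => -[_] /=; rewrite in_itv /= /uniform_pdf => ->.
  by rewrite subr0 invr1.
rewrite integral_cst // mul1e.
apply: (@le_trans _ _ (lebesgue_measure `[c, c + l[)).
  apply: le_measure; rewrite ?inE //.
  by move=> u [/= Au]; rewrite in_itv /= => /clamp01_id ucl; rewrite in_itv /= -ucl.
rewrite lebesgue_measure_itv /= lte_fin; case: ifPn => [_|_]; last by rewrite lee_fin.
by rewrite -EFinB addrC addKr.
Qed.

Lemma small_rect (c1 l1 c2 l2 : R) : 0 <= l1 -> 0 <= l2 ->
  small [set w | (c1 <= clamp01 w.1 < c1 + l1) && (c2 <= clamp01 w.2 < c2 + l2)] (l1 * l2).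
Proof.
move=> l10 l20; have [m1 p1] := coord_prob_interval c1 l10.
have [m2 p2] := coord_prob_interval c2 l20.
exists ([set u | c1 <= clamp01 u < c1 + l1] `*` [set u | c2 <= clamp01 u < c2 + l2]).
split; first exact: measurableX.
  by move=> w /= /andP[].
by rewrite /seed_prob /= product_measure1E // EFinM lee_pmul.
Qed.

Lemma small_strip (b : bool) (c l : R) : 0 <= l ->
  small [set w | c <= clamp01 (if b then w.2 else w.1) < c + l] l.
Proof.
move=> l0; have [m p] := coord_prob_interval c l0.
case: b.
  exists (setT `*` [set u | c <= clamp01 u < c + l]); split; first exact: measurableX.
    by move=> w.
  rewrite [leLHS](product_measure1E coord_prob coord_prob) //.
  by rewrite [X in (X * _)%E](_ : _ = 1%E) ?mul1e //; exact: (@probability_setT _ _ _ coord_prob).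
exists ([set u | c <= clamp01 u < c + l] `*` setT); split; first exact: measurableX.
  by move=> w.
rewrite [leLHS](product_measure1E coord_prob coord_prob) //.
by rewrite [X in (_ * X)%E](_ : _ = 1%E) ?mule1 //; exact: (@probability_setT _ _ _ coord_prob).
Qed.

End RandomCuts.

(** * Probability that two points are separated at a given scale *)

Section CutProbability.
Variable R : realType.
Local Open Scope classical_set_scope.
Local Notation pow2 i := ((2 : R) ^ (i : int)).
Local Notation seed := (measurableTypeR R * measurableTypeR R)%type.
Implicit Types (x y : R) (h : seq R) (i j : int) (w : seed) (b : bool).

(** Indexing by a boolean makes [~~ b] the partner of [b] and treats both cuts at once. *)
Definition cut b w i j : R := if b then cut2 w i j else cut1 w i j.

Let off b : R := if b then 2 else 0.
Let coord b w : R := clamp01 (if b then w.2 else w.1).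

Lemma cut_ltE b w i j x d :
  (x <= cut b w i j < x + d) =
  (x / pow2 i - 4 * j%:~R - off b <= coord b w
     < x / pow2 i - 4 * j%:~R - off b + d / pow2 i).
Proof.
have -> : cut b w i j = pow2 i * (4 * j%:~R + off b + coord b w).
  by rewrite /cut /cut1 /cut2 /coord /off; case: b => //; rewrite addr0.
rewrite -ler_pdivrMl ?pow2_gt0 // -ltr_pdivlMl ?pow2_gt0 // ![_^-1 * _]mulrC mulrDl.
by apply/idP/idP => /andP[? ?]; apply/andP; split; lra.
Qed.

(** Over all seeds, the cut [b] of a block stays in an interval of length [2 ^ i], and these
    intervals are [3 * 2 ^ i] apart for consecutive blocks. A window of length at most [2 ^ i] can
    thus be hit from one block only. *)
Lemma cut_unique b w w' i j j' x d : d <= pow2 i ->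
  x <= cut b w i j < x + d -> x <= cut b w' i j' < x + d -> j = j'.
Proof.
rewrite !cut_ltE -[X in _ <= X]mul1r -ler_pdivrMr ?pow2_gt0 // => ds.
have := clamp01_ge0 (if b then w.2 else w.1); have := clamp01_le1 (if b then w.2 else w.1).
have := clamp01_ge0 (if b then w'.2 else w'.1); have := clamp01_le1 (if b then w'.2 else w'.1).
rewrite -/(coord b w) -/(coord b w') => ? ? ? ? /andP[? ?] /andP[? ?].
by apply/le_anti/andP; split; rewrite -ltzD1 -(ltr_int R) intrD; lra.
Qed.

Lemma small_hit b i x d : 0 <= d ->
  small [set w | exists j, x <= cut b w i j < x + d] (d / pow2 i).
Proof.
move=> d0; have [ds|ds] := leP d (pow2 i); last first.
  by apply: small1; rewrite ler_pdivlMr ?pow2_gt0 // mul1r ltW.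
(* If some seed hits the window, its block [j0] is the only one that any seed can use, so the event
   lies in a single strip. *)
have [[w0 [j0 hj0]]|none] := pselect (exists w j, x <= cut b w i j < x + d); last first.
  apply: small0 => [w [j hj]|]; first by apply: none; exists w, j.
  by rewrite divr_ge0 // ltW ?pow2_gt0.
have d20 : 0 <= d / pow2 i by rewrite divr_ge0 // ltW ?pow2_gt0.
apply: small_sub (lexx _) (small_strip b (x / pow2 i - 4 * j0%:~R - off b) d20).
by move=> w [j hj]; rewrite (cut_unique ds hj0 hj); move: hj; rewrite cut_ltE.
Qed.

(** The cuts of a pair are between [2 ^ i] and [3 * 2 ^ i] apart. If [x] and [p] each lie less than
    [2 ^ i / 3] to the left of a different one of them, their distance falls in this range. *)
Definition nearby i x (p : R) : bool := pow2 i / 2 <= `|x - p| <= 4 * pow2 i.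

Variable N : nat.
Hypothesis N2 : (2 <= N)%N.
Local Notation th i := (threshold R N i).

Lemma threshold_le i : th i <= pow2 i / 3.
Proof.
rewrite /threshold ler_pM2l ?pow2_gt0 // lef_pV2 ?posrE ?ltr0n //.
by rewrite ler_nat.
Qed.

Lemma threshold_gt0 i : 0 < th i.
Proof. by rewrite divr_gt0 ?pow2_gt0 ?ltr0n. Qed.

(* Both cuts of one pair are hit: for a fixed history point [p] this is a
   rectangle of sides [d / 2 ^ i] and [1 / N.+1], empty unless [p] is at
   distance about [2 ^ i] from [x]. *)
Lemma small_hit_bad b i x d h : 0 <= d < th i ->
  small [set w | exists j, x <= cut b w i j < x + d /\ bad_cut (th i) h (cut (~~ b) w i j)]
    (\sum_(p <- undup h) d / pow2 i / N.+1%:R * (nearby i x p)%:R).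
Proof.
move=> /andP[d0 dth].
have s0 := pow2_gt0 R i; have th3 := threshold_le i.
have ds : d <= pow2 i by lra.
have th0 := threshold_gt0 i.
have e0 : 0 <= d / pow2 i by rewrite divr_ge0 // ltW.
have N0 : 0 <= N.+1%:R^-1 :> R by rewrite invr_ge0.
have [[w0 [j0 hj0]]|none] := pselect (exists w j, x <= cut b w i j < x + d); last first.
  apply: small0 => [w [j [hj _]]|]; first by apply: none; exists w, j.
  by apply: sumr_ge0 => p _; rewrite mulr_ge0 // mulr_ge0.
(* A bad partner cut lies less than [th i] to the right of a history point [p]. Forgetting the other
   point [q] makes the union bound run over points instead of pairs. *)
pose E p := [set w | x <= cut b w i j0 < x + d /\ p <= cut (~~ b) w i j0 < p + th i].
suff hE p : small (E p) (d / pow2 i / N.+1%:R * (nearby i x p)%:R).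
  apply: small_sub (lexx _) (small_has (fun p _ => hE p)).
  move=> w [j [hj /bad_cutP[p [q [ph _ pc cq qp]]]]].
  exists p; first by rewrite mem_undup.
  by rewrite /E /= (cut_unique ds hj0 hj) hj pc; split => //; lra.
have [near|far] := boolP (nearby i x p); last first.
  rewrite mulr0; apply: small0 => // w [/andP[h1 h2] /andP[h3 h4]].
  move: far; rewrite /nearby => /negP; apply.
  have u0 := clamp01_ge0 w.1; have u1 := clamp01_le1 w.1.
  have v0 := clamp01_ge0 w.2; have v1 := clamp01_le1 w.2.
  have c12 : cut2 w i j0 - cut1 w i j0 = pow2 i * (2 + clamp01 w.2 - clamp01 w.1).
    by rewrite /cut1 /cut2; ring.
  have c1 : pow2 i <= cut2 w i j0 - cut1 w i j0.
    by rewrite c12 ler_peMr ?(ltW s0) //; lra.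
  have c3 : cut2 w i j0 - cut1 w i j0 <= 3 * pow2 i.
    by rewrite c12 mulrC ler_pM2r //; lra.
  move: h1 h2 h3 h4; rewrite /cut; case: (b) => /= *.
    by rewrite ger0_norm; [apply/andP; split|]; lra.
  by rewrite distrC ger0_norm; [apply/andP; split|]; lra.
rewrite mulr1.
have thE : th i / pow2 i = N.+1%:R^-1.
  by rewrite /threshold mulrAC divff ?mul1r // gt_eqF.
case: (b) @E => E.
- have := small_rect (p / pow2 i - 4 * j0%:~R - off false) (x / pow2 i - 4 * j0%:~R - off true) N0 e0.
  rewrite [X in small _ X]mulrC => r; apply: small_sub (lexx _) r => w [].
  by rewrite !cut_ltE thE => /= h1 h2; apply/andP.
- have := small_rect (x / pow2 i - 4 * j0%:~R - off false) (p / pow2 i - 4 * j0%:~R - off true) e0 N0.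
  move=> r; apply: small_sub (lexx _) r => w [].
  by rewrite !cut_ltE thE => /= h1 h2; apply/andP.
Qed.

(** Up to scale [N.+1 * (y - x)], the event is covered by hits of the first or the second cut. Above
    it every separating cut is bad, so its partner must be bad too, which leaves only the sum over
    nearby history points. *)
Lemma cut_level_prob h x y i : x \in h -> y \in h -> x <= y ->
  (seed_prob R [set w | cut_level N w h x y i] <=
    (2 * ((y - x) / pow2 i) * ((pow2 i <= N.+1%:R * (y - x))%R%:R +
       N.+1%:R^-1 * \sum_(p <- undup h) (nearby i x p)%:R))%:E)%E.
Proof.
move=> xh yh xy; apply: small_measure; first exact: measurable_cut_level.
have s0 := pow2_gt0 R i.
have d0 : 0 <= y - x by rewrite subr_ge0.
have sE w c : separates c x y = (x <= c < x + (y - x)).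
  by rewrite separatesE // addrC subrK.
have S0 : 0 <= N.+1%:R^-1 * \sum_(p <- undup h) (nearby i x p)%:R :> R.
  by rewrite mulr_ge0 ?invr_ge0 ?sumr_ge0.
have e0 : 0 <= (y - x) / pow2 i by rewrite divr_ge0 // ltW.
have [big|small] := leP (pow2 i) (N.+1%:R * (y - x)).
  apply: small_sub (smallU (small_hit false i x d0) (small_hit true i x d0)).
    move=> w [j]; rewrite /cut_alive !sE // => /orP[] /andP[hj _]; [left|right];
    by exists j.
  have aux (e S : R) : 0 <= e -> 0 <= S -> e + e <= 2 * e * (1 + S) by move=> *; nra.
  exact: aux.
have dth : 0 <= y - x < th i.
  by rewrite d0 /= /threshold ltr_pdivlMr ?ltr0n // mulrC.
apply: small_sub (smallU (small_hit_bad false x h dth) (small_hit_bad true x h dth)).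
  move=> w [j].
  have bad c : separates c x y -> bad_cut (th i) h c.
    rewrite separatesE // => /andP[xc cy]; apply/bad_cutP; exists x, y.
    by case/andP: dth.
  rewrite /cut_alive => /orP[] /andP[hj sj]; [left|right]; exists j; rewrite /= -sE //; split => //.
    exact: pair_status_bad1 sj (bad _ hj).
  exact: pair_status_bad2 sj (bad _ hj).
have aux (e c S : R) : e / c * S + e / c * S <= 2 * e * (c^-1 * S) by lra.
by rewrite add0r -!mulr_sumr aux.
Qed.

End CutProbability.

(** * Expected distances *)

Section Expectation.
Variable R : realType.
Local Open Scope classical_set_scope.
Local Notation pow2 i := ((2 : R) ^ (i : int)).
Local Notation seed := (measurableTypeR R * measurableTypeR R)%type.
Implicit Types (x y : R) (h : seq R) (i j : int) (w : seed).

(** The indices satisfying [Q] are among the four numbers starting at the least one. *)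
Lemma sum_window (Q : pred nat) m : (forall k k', Q k -> Q k' -> (k' <= k + 3)%N) ->
  (\sum_(k < m) Q k <= 4)%N.
Proof.
move=> hQ; set S := (\sum_(k < m) _)%N.
have -> : S = size (seq.filter Q (iota 0 m)).
  rewrite size_filter -sum1_count big_mkcond /= -{1}(subn0 m) -/(index_iota 0 m) big_mkord.
  by apply: eq_bigr => k _; case: (Q k).
have [exQ|noQ] := pselect (exists k, Q k); last first.
  by rewrite size_filter (@eq_count _ _ pred0) ?count_pred0 // => k;
    apply/negbTE/negP => Qk; apply: noQ; exists k.
case: (ex_minnP exQ) => k0 Qk0 k0min; rewrite -[4%N](size_iota k0).
apply: uniq_leq_size => [|k]; first by rewrite filter_uniq // iota_uniq.
rewrite mem_filter !mem_iota => /andP[Qk _].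
by rewrite k0min //= addnS ltnS; apply: hQ.
Qed.

Lemma sum_ltn_le (m L : nat) : (\sum_(k < m) (k < L) <= L)%N.
Proof.
suff: (\sum_(k < m) (k < L) <= minn m L)%N by rewrite leq_min => /andP[].
elim: m => [|m IH]; first by rewrite big_ord0.
by rewrite big_ord_recr /=; move: IH; rewrite !leq_min; case: (ltnP m L) => /= ?; lia.
Qed.

Lemma pow2D i (k : nat) : pow2 (i + k) = pow2 i * 2 ^+ k.
Proof. by rewrite expfzDr // exprnP. Qed.

(** The two bounds in [nearby] differ by a factor [2 ^ 3], which leaves room for four scales. *)
Lemma nearby_sum i x (p : R) m : \sum_(k < m) (nearby (i + k%:Z) x p)%:R <= 4 :> R.
Proof.
rewrite -natr_sum ler_nat.
apply: (@sum_window (fun k => nearby (i + k%:Z) x p)) => k k'.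
have s0 := pow2_gt0 R i.
rewrite /nearby !pow2D => /andP[_ h1] /andP[h2 _].
have : 2 ^+ k' <= 2 ^+ (k + 3) :> R.
  by rewrite exprD -(ler_pM2l s0); lra.
by rewrite ler_eXn2l // ltr1n.
Qed.

Variable N : nat.

Definition level_event h x y i : set seed := [set w | cut_level N w h x y i].

(** Level [i] separates for every seed and dominates the lower levels; the diameter of the history
    excludes high ones. So the supremum is a finite maximum whose range is the same for all
    seeds. *)
Lemma hdist_bigmax h x y i : x \in h -> y \in h ->
  8 * pow2 i <= `|x - y| ->
  exists m, forall w, hdist N w h x y =
    \big[Num.max/0]_(k < m) (16 * pow2 (i + k%:Z) * \1_(level_event h x y (i + k%:Z)) w).
Proof.
move=> xh yh long; have [B hB] := history_diam h.
have s0 := pow2_gt0 R i.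
have B0 : 0 <= B by rewrite -(subrr x); apply: hB.
have NB0 : 0 <= N.+1%:R * B / pow2 i by rewrite divr_ge0 ?mulr_ge0 // ltW.
pose m := Num.bound (N.+1%:R * B / pow2 i).
have mP k : (m <= k)%N -> N.+1%:R * B < pow2 (i + k%:Z).
  move=> mk; rewrite pow2D -ltr_pdivrMl // mulrC.
  apply: lt_le_trans (archi_boundP NB0) _.
  by rewrite -natrX ler_nat (leq_trans mk) // ltnW // ltn_expl.
exists m => w; apply/le_anti/andP; split.
  have ge k : (k < m)%N -> cut_level N w h x y (i + k%:Z) ->
      16 * pow2 (i + k%:Z) <= \big[Num.max/0]_(k < m)
        (16 * pow2 (i + k%:Z) * \1_(level_event h x y (i + k%:Z)) w).
    move=> km hk; rewrite (bigD1 (Ordinal km)) //= le_max; apply/orP; left.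
    by rewrite indicE mem_set // mulr1.
  apply: hdist_le => [|i' hi'].
    by elim/big_ind: _ => // [a b a0 b0|k _]; rewrite ?le_max ?a0 // !mulr_ge0 // ltW // pow2_gt0.
  have small_k k : cut_level N w h x y (i + k%:Z) -> (k < m)%N.
    move=> hk; rewrite ltnNge; apply/negP => /mP; rewrite ltNge => /negP; apply.
    exact: cut_level_bound hk.
  have [ii'|i'i] := leP i i'.
    have e : i' = i + (`|i' - i|%N)%:Z by lia.
    by rewrite e in hi' *; apply: ge => //; apply: small_k.
  have h0 : cut_level N w h x y (i + 0%:Z) by rewrite addr0; exact: cut_level_exists.
  apply: le_trans (ge 0%N (small_k _ h0) h0).
  by rewrite addr0 ler_pM2l // ler_weXz2l // ?ler1n // ltW.
elim/big_ind: _ => [|a b ha hb|k _]; first exact: hdist_ge0.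
  by rewrite ge_max ha.
rewrite indicE; case: (boolP (w \in _)) => [/set_mem hk|_].
  by rewrite mulr1; exact: cut_level_hdist.
by rewrite mulr0 hdist_ge0.
Qed.

Lemma measurable_bigmax d (T : measurableType d) (m : nat) (f : 'I_m -> T -> R) :
  (forall k, measurable_fun setT (f k)) ->
  measurable_fun setT (fun t => \big[Num.max/0]_(k < m) f k t).
Proof.
move=> mf; elim: (index_enum _) => [|k s IH].
  by rewrite (_ : (fun _ => _) = cst 0); [exact: measurable_cst|
    apply/funext => t; rewrite big_nil].
rewrite (_ : (fun _ => _) = fun t => Num.max (f k t) (\big[Num.max/0]_(k <- s) f k t)).
  exact: measurable_maxr.
by apply/funext => t; rewrite big_cons.
Qed.

Lemma measurable_level_event h x y i : measurable (level_event h x y i).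
Proof. exact: measurable_cut_level. Qed.

Lemma measurable_level_indic h x y i :
  measurable_fun setT (\1_(level_event h x y i) : seed -> R).
Proof. by apply: measurable_indic; exact: measurable_level_event. Qed.

Lemma measurable_hdist h x y : x \in h -> y \in h ->
  measurable_fun setT (fun w : seed => hdist N w h x y).
Proof.
move=> xh yh; have [<-|/dyadic_bracket[i /andP[long _]]] := eqVneq x y.
  rewrite (_ : (fun _ => _) = cst 0); first exact: measurable_cst.
  by apply/funext => w; rewrite hdistxx.
have [m hm] := hdist_bigmax xh yh long.
rewrite (funext hm).
apply: measurable_bigmax => k; apply: measurable_funM => //.
exact: measurable_level_indic.
Qed.

(** The maximum over levels is at most the sum. Each level costs [32 * |x - y|] times the bracket of
    [cut_level_prob]; the brackets add up to [L] for the low levels, plus 4 from at most [N.+1]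
    history points, each counted at most four times with weight [1 / N.+1]. *)
Lemma hdist_expectation h x y (L : nat) : (2 <= N)%N -> x \in h -> y \in h ->
  (size (undup h) <= N.+1)%N -> (16 * N.+1 <= 2 ^ L)%N ->
  (\int[seed_prob R]_w (hdist N w h x y)%:E <= (32 * (L + 4)%:R * `|x - y|)%:E)%E.
Proof.
move=> N2 xh yh sz hL; wlog xy : x y xh yh / x <= y.
  move=> hw; case: (leP x y) => [|/ltW] xy; first exact: hw.
  by rewrite distrC; under eq_integral do rewrite hdistC; exact: hw.
have [<-|neq] := eqVneq x y.
  rewrite subrr normr0 mulr0; under eq_integral do rewrite hdistxx.
  by rewrite integral0.
have [i /andP[long short]] := dyadic_bracket neq.
have [m hm] := hdist_bigmax xh yh long.
have d0 : 0 <= y - x by rewrite subr_ge0.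
move: short; rewrite distrC ger0_norm // => short.
have s0 := pow2_gt0 R i.
pose c k := 16 * pow2 (i + k%:Z).
have c0 k : 0 <= c k by rewrite mulr_ge0 // ltW // pow2_gt0.
pose E k := level_event h x y (i + k%:Z).
apply: (@le_trans _ _ (\int[seed_prob R]_w (\sum_(k < m) (c k * \1_(E k) w)%:E))%E).
  apply: ge0_le_integral => //.
  - by move=> w _; rewrite lee_fin hdist_ge0.
  - by apply/measurable_EFinP; exact: measurable_hdist.
  - apply: emeasurable_sum => k; apply/measurable_EFinP; apply: measurable_funM => //.
    exact: measurable_level_indic.
  - move=> w _; rewrite sumEFin lee_fin hm.
    have t0 k : 0 <= c k * \1_(E k) w by rewrite mulr_ge0.
    elim/big_ind: _ => [|a b ha hb|k _]; first by apply: sumr_ge0.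
      by rewrite ge_max ha.
    by rewrite (bigD1 k) //= lerDl sumr_ge0.
rewrite ge0_integral_sum //; last first.
- by move=> k w _; rewrite lee_fin mulr_ge0.
- move=> k; apply/measurable_EFinP; apply: measurable_funM => //.
  exact: measurable_level_indic.
apply: (@le_trans _ _ (\sum_(k < m) (32 * (y - x) * ((k < L)%N%:R +
    N.+1%:R^-1 * \sum_(p <- undup h) (nearby (i + k%:Z) x p)%:R))%:E)%E).
  apply: lee_sum => k _.
  under eq_integral do rewrite EFinM.
  rewrite ge0_integralZl_EFin //; last first.
    by apply/measurable_EFinP; exact: measurable_level_indic.
  rewrite integral_indic ?setIT //; last exact: measurable_level_event.
  apply: le_trans (lee_wpmul2l _ (cut_level_prob N2 _ xh yh xy)) _; first by rewrite lee_fin.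
  rewrite -EFinM lee_fin /c.
  have -> (s e S : R) : 16 * s * (2 * (e / s) * S) = 32 * e * (s / s * S) by ring.
  rewrite divff ?gt_eqF ?pow2_gt0 // mul1r ler_wpM2l ?mulr_ge0 // lerD2r ler_nat.
  (* From [2 ^ (i + k) <= N.+1 * (y - x)] and [y - x < 16 * 2 ^ i] follows
     [2 ^ k < 16 * N.+1 <= 2 ^ L]. *)
  case: (leP (pow2 _)) => // le_k; rewrite lt0b.
  rewrite -(@ltr_eXn2l R 2) ?ltr1n //.
  have hL' : 16 * N.+1%:R <= 2 ^+ L :> R by rewrite -natrX -natrM ler_nat.
  apply: lt_le_trans hL'; rewrite -(ltr_pM2l s0) -pow2D (le_lt_trans le_k) //.
  have -> (s n : R) : s * (16 * n) = n * (16 * s) by ring.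
  by rewrite ltr_pM2l ?ltr0n.
rewrite sumEFin lee_fin -mulr_sumr [leRHS]mulrAC.
rewrite ler_wpM2l ?mulr_ge0 // big_split /= -mulr_sumr natrD lerD //.
  by rewrite -natr_sum ler_nat; exact: sum_ltn_le.
rewrite exchange_big /= ler_pdivrMl ?ltr0n //.
apply: (@le_trans _ _ (\sum_(p <- undup h) 4)).
  by apply: ler_sum => p _; exact: nearby_sum.
by rewrite big_const_seq count_predT iter_addr addr0 -[_ *+ size _]mulr_natl ler_pM2r // ler_nat.
Qed.

End Expectation.

(** * The embedding of [R^D] *)

Section Embedding.
Variables (R : realType) (D : nat).
Local Open Scope classical_set_scope.
Local Notation point := (linf_point R D).
Local Notation seed := (measurableTypeR R * measurableTypeR R)%type.
Implicit Types (s : seq (update R D)) (u v p : point) (k : 'I_D) (w : seed).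

Definition seen s : seq point := map fst s.

Lemma alive_rcons s (p : update R D) u :
  alive (rcons s p) u = if p.1 == u then p.2 else alive s u.
Proof. by rewrite /alive -cats1 foldl_cat. Qed.

Lemma alive_seen s u : alive s u -> u \in seen s.
Proof.
elim/last_ind: s => // s p IH; rewrite alive_rcons /seen map_rcons mem_rcons inE.
by case: eqP => [->|_ /IH ->]; rewrite ?eqxx ?orbT.
Qed.

(* Departed points stay in the history: no deletion of a cut is ever undone. *)
Definition history s k : seq R := [seq (q : update R D).1 ord0 k | q <- rev s].

Lemma history_rcons s (q : update R D) k : history (rcons s q) k = q.1 ord0 k :: history s k.
Proof. by rewrite /history rev_rcons. Qed.

Lemma mem_history s u k : u \in seen s -> u ord0 k \in history s k.
Proof.
case/mapP => q qs ->; apply/mapP; exists q => //.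
by rewrite mem_rev.
Qed.

Lemma size_history s k : (size (undup (history s k)) <= size (undup (seen s)))%N.
Proof.
rewrite -(size_map (fun p : point => p ord0 k)); apply: uniq_leq_size (undup_uniq _) _.
move=> x; rewrite mem_undup => /mapP[q]; rewrite mem_rev => qs ->.
by apply/mapP; exists q.1 => //; rewrite mem_undup map_f.
Qed.

Lemma linf_ge u v k : `|u ord0 k - v ord0 k| <= linf u v.
Proof. by rewrite /linf (bigD1 k) //= le_max lexx. Qed.

Lemma linf_ge0 u v : 0 <= linf u v.
Proof.
rewrite /linf; elim/big_ind: _ => // a b a0 b0; first by rewrite le_max a0.
Qed.

Lemma linfxx u : linf u u = 0.
Proof.
apply/le_anti; rewrite linf_ge0 andbT /linf.
by elim/big_ind: _ => // [a b ha hb|k _]; rewrite ?ge_max ?ha // subrr normr0.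
Qed.

Lemma linf_neq u v : u != v -> exists k, u ord0 k != v ord0 k.
Proof.
move=> uv; apply: contrapT => h; case/eqP: uv; apply/rowP => k.
by apply/eqP; apply: contraT => ne; case: h; exists k.
Qed.

Variable N : nat.

(** Off the history the levels may be unbounded, hence the value 0 there; alive points are always
    seen. *)
Definition embed w s u v : R :=
  if (u \in seen s) && (v \in seen s) then
    \big[Num.max/0]_(k < D) hdist N w (history s k) (u ord0 k) (v ord0 k)
  else 0.

Section Points.
Variable w : seed.

Lemma embed_ge s u v k : u \in seen s -> v \in seen s ->
  hdist N w (history s k) (u ord0 k) (v ord0 k) <= embed w s u v.
Proof. by move=> us vs; rewrite /embed us vs (bigD1 k) //= le_max lexx. Qed.

Lemma embed_le s u v r : 0 <= r ->
  (forall k, u \in seen s -> v \in seen s ->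
     hdist N w (history s k) (u ord0 k) (v ord0 k) <= r) ->
  embed w s u v <= r.
Proof.
move=> r0 hr; rewrite /embed; case: ifPn => // /andP[us vs].
by elim/big_ind: _ => // [a b ha hb|k _]; [rewrite ge_max ha|exact: hr].
Qed.

Lemma embed_ge0 s u v : 0 <= embed w s u v.
Proof.
rewrite /embed; case: ifPn => // /andP[us vs].
elim/big_ind: _ => // [a b a0 b0|k _]; first by rewrite le_max a0.
by apply: hdist_ge0; exact: mem_history.
Qed.

Lemma embedxx s u : embed w s u u = 0.
Proof.
by apply/le_anti; rewrite embed_ge0 embed_le // => k _ _; rewrite hdistxx.
Qed.

Lemma embedC s u v : embed w s u v = embed w s v u.
Proof. by rewrite /embed andbC; under eq_bigr do rewrite hdistC. Qed.

Lemma embed_dominates s u v : u \in seen s -> v \in seen s -> linf u v <= embed w s u v.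
Proof.
move=> us vs; rewrite /linf; elim/big_ind: _ => [|a b ha hb|k _].
- exact: embed_ge0.
- by rewrite ge_max ha.
- by apply: le_trans (embed_ge k us vs); apply: hdist_ge; exact: mem_history.
Qed.

Lemma embed_ultra s u v x : u \in seen s -> v \in seen s -> x \in seen s ->
  embed w s u x <= Num.max (embed w s u v) (embed w s v x).
Proof.
move=> us vs xs; apply: embed_le => [|k _ _]; first by rewrite le_max embed_ge0.
apply: le_trans (hdist_ultra N w (mem_history k us) (mem_history k vs) (mem_history k xs)) _.
by rewrite ge_max !le_max !embed_ge // orbT.
Qed.

Lemma embed_rcons s u v q : u \in seen s -> v \in seen s ->
  embed w (rcons s q) u v <= embed w s u v.
Proof.
move=> us vs; apply: embed_le => [|k _ _]; first exact: embed_ge0.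
rewrite history_rcons; apply: le_trans (embed_ge k us vs).
by apply: hdist_cons; exact: mem_history.
Qed.

End Points.

Lemma embed_online_monotone w : online_monotone_embedding (embed w).
Proof.
move=> s q; split.
- apply: (@ultrametric_is_HST _ _ (seen (rcons s q))) => [u|u _|u v|u v _ _|u v x].
  + exact: alive_seen.
  + exact: embedxx.
  + move=> /alive_seen us /alive_seen vs /linf_neq[k uvk].
    apply: lt_le_trans (embed_dominates w us vs).
    by apply: lt_le_trans (linf_ge u v k); rewrite normr_gt0 subr_eq0.
  + exact: embedC.
  + by move=> /alive_seen us /alive_seen vs /alive_seen xs; exact: embed_ultra.
- by move=> u v /alive_seen us /alive_seen vs; exact: embed_dominates.
- by move=> u v /alive_seen us /alive_seen vs _ _; exact: embed_rcons.
Qed.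

Lemma measurable_embed s u v : measurable_fun setT (fun w : seed => embed w s u v).
Proof.
rewrite /embed; case: (boolP ((u \in _) && _)) => [/andP[us vs]|_]; last exact: measurable_cst.
by apply: measurable_bigmax => k; apply: measurable_hdist; exact: mem_history.
Qed.

(** Bounding the maximum over coordinates by the sum costs the factor [D]. Only union bounds and
    linearity of expectation combine coordinates, levels and blocks, so all of them can share one
    seed. *)
Lemma embed_expectation s u v (L : nat) : (2 <= N)%N -> u \in seen s -> v \in seen s ->
  (size (undup (seen s)) <= N.+1)%N -> (16 * N.+1 <= 2 ^ L)%N ->
  (\int[seed_prob R]_w (embed w s u v)%:E <= (D%:R * (32 * (L + 4)%:R * linf u v))%:E)%E.
Proof.
move=> N2 us vs sz hL.
pose f k w := hdist N w (history s k) (u ord0 k) (v ord0 k).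
have f0 k w : 0 <= f k w by apply: hdist_ge0; exact: mem_history.
have mf k : measurable_fun setT (f k) by apply: measurable_hdist; exact: mem_history.
apply: (@le_trans _ _ (\int[seed_prob R]_w (\sum_(k < D) (f k w)%:E))%E).
  apply: ge0_le_integral => //.
  - by move=> w _; rewrite lee_fin embed_ge0.
  - by apply/measurable_EFinP; exact: measurable_embed.
  - by apply: emeasurable_sum => k; exact/measurable_EFinP.
  - move=> w _; rewrite sumEFin lee_fin; apply: embed_le => [|k _ _].
      exact: sumr_ge0.
    by rewrite -/(f k w) (bigD1 k) //= lerDl sumr_ge0.
rewrite ge0_integral_sum //; last first.
- by move=> k w _; rewrite lee_fin.
- by move=> k; exact/measurable_EFinP.
apply: (@le_trans _ _ (\sum_(k < D) (32 * (L + 4)%:R * linf u v)%:E)%E).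
  apply: lee_sum => k _.
  apply: le_trans (hdist_expectation N2 (mem_history k us) (mem_history k vs) _ hL) _.
    exact: leq_trans (size_history s k) sz.
  by rewrite lee_fin ler_wpM2l ?mulr_ge0 // linf_ge.
by rewrite sumEFin lee_fin sumr_const card_ord -[_ *+ D]mulr_natl.
Qed.

End Embedding.

(** * The number of scales in terms of the logarithm, and the final bound *)

Lemma levels_log (R : realType) (n : nat) : (2 <= n)%N ->
  exists2 L : nat, (16 * n.+3 <= 2 ^ L)%N & (L + 4)%:R * ln 2 <= 12 * ln n%:R :> R.
Proof.
move=> n2; exists (up_log 2 (16 * n.+3)); first exact: up_logP.
have lt_n : (2 ^ (up_log 2 (16 * n.+3)).-1 < 16 * n.+3)%N.
  by apply: up_log_gtn; lia.
(* Minimality of [L] gives [2 ^ (L - 1) < n ^ 7], so [L - 1] costs 7 logarithms; the remaining 5 in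
   [L + 4] cost 5 more as [ln 2 <= ln n]. *)
have n7 : (16 * n.+3 <= n ^ 7)%N.
  apply: (@leq_trans (n * 2 ^ 6)); first by lia.
  by rewrite (expnS n) leq_mul2l leq_exp2r // n2 orbT.
set L := up_log _ _ in lt_n *.
have ln2 : 0 < ln 2 :> R by rewrite ln_gt0 // ltr1n.
have h1 : ln 2 <= ln n%:R :> R by rewrite ler_ln ?posrE ?ltr0n ?ler_nat //; lia.
have h2 : L.-1%:R * ln 2 <= 7 * ln n%:R :> R.
  rewrite !mulr_natl -!lnXn ?ltr0n //; last by lia.
  by rewrite ler_ln ?posrE ?exprn_gt0 ?ltr0n -?natrX ?ler_nat //; lia.
have h3 : (L + 4)%:R <= L.-1%:R + 5 :> R by rewrite -natrD ler_nat; lia.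
apply: le_trans (_ : (L.-1%:R + 5) * ln 2 <= _); first by rewrite ler_pM2r.
by rewrite mulrDl; lra.
Qed.

Unset Implicit Arguments.

Theorem mainTheorem18 (R : realType) :
  exists C : R, 0 < C /\
  forall (D n : nat),
  exists (d : measure_display) (Omega : measurableType d)
         (P : probability Omega R)
         (A : Omega -> seq (update R D) -> linf_point R D -> linf_point R D -> R),
    [/\ (forall w, online_monotone_embedding (A w)),
        (forall s u v, measurable_fun setT (fun w => A w s u v)) &
        (forall s : seq (update R D), (size (undup (map fst s)) <= n)%N ->
         forall (t : nat) (u v : linf_point R D),
           alive (take t s) u -> alive (take t s) v ->
           (\int[P]_w (A w (take t s) u v)%:E
              <= (C * D%:R * ln ((n * D)%:R) * linf u v)%:E)%E)].
Proof.
have ln2 : 0 < ln 2 :> R by rewrite ln_gt0 // ltr1n.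
(* 384 is 32 from [embed_expectation] times 12 from [levels_log]. *)
exists (384 / ln 2); split; first by rewrite divr_gt0 ?ltr0n.
(* Taking [N = n.+2] ensures [2 <= N] for every [n], and [N.+1] exceeds the number of points. *)
move=> D n; exists _, _, (seed_prob R), (embed n.+2); split.
- exact: embed_online_monotone.
- by move=> s u v; exact: measurable_embed.
move=> s sz t u v /alive_seen us /alive_seen vs.
(* For equal points both sides vanish. Distinct ones force [2 <= n] and [0 < D], which settles the
   degenerate values of the logarithm. *)
have [<-|uv] := eqVneq u v.
  under eq_integral do rewrite embedxx.
  by rewrite integral0 linfxx mulr0.
have szt : (size (undup (seen (take t s))) <= n)%N.
  apply: leq_trans sz; apply: uniq_leq_size (undup_uniq _) _ => x.
  by rewrite !mem_undup /seen map_take => /mem_take.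
have n2 : (2 <= n)%N.
  apply: leq_trans szt; rewrite -[2%N]/(size [:: u; v]).
  apply: uniq_leq_size => [|x]; first by rewrite /= inE uv.
  by rewrite !inE mem_undup => /orP[]/eqP->.
have [L hL lnL] := levels_log R n2.
have szN : (size (undup (seen (take t s))) <= n.+3)%N by lia.
apply: le_trans (embed_expectation (N := n.+2) isT us vs szN hL) _.
rewrite lee_fin.
have [k _] := linf_neq uv.
have D0 : (0 < D)%N by case: (D) k => // [[]].
have lnD : ln n%:R <= ln (n * D)%:R :> R.
  by rewrite ler_ln ?posrE ?ltr0n ?ler_nat ?muln_gt0 ?leq_pmulr //; lia.
have -> : D%:R * (32 * (L + 4)%:R * linf u v) = (32 * (L + 4)%:R) * (D%:R * linf u v) by ring.
have -> : 384 / ln 2 * D%:R * ln (n * D)%:R * linf u v =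
  (384 / ln 2 * ln (n * D)%:R) * (D%:R * linf u v) by ring.
rewrite ler_wpM2r ?mulr_ge0 ?linf_ge0 // mulrAC ler_pdivlMr //.
by rewrite -mulrA; lra.
Qed.
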